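(* Let $N\ge 1$ and let $\rho$ be an arbitrary $N$-qubit density matrix, i.e. a density matrix on $(\mathbb{C}^2)^{\otimes N}$. Then the asymmetry of $\rho$ with respect to the group of independent local unitaries $\mathbb{SU}(2)^{\otimes N}$ is $$\mathcal{A}(\mathbb{SU}(2)^{\otimes N},\rho)=\frac12-\frac{1}{2^{N+1}\,\mathrm{Tr}\rho^2}=\frac12-\frac{1}{2+2(2^N-1)\,\mathcal{C}^2(\rho)}=\frac12-\frac{1}{2+2^{N+1}\,\mathcal{I}_{BZ}(\rho)}.$$
   Context: A density matrix is a positive semidefinite complex matrix of trace $1$. The Frobenius norm is $\|A\|_{\mathrm{F}}=\sqrt{\mathrm{Tr}(A^\dagger A)}$, and $[A,B]=AB-BA$. For a compact group $G$ with unitary representation $g\mapsto U(g)$ on the Hilbert space of $\rho$, the asymmetry measure is $$\mathcal{A}(G,\rho)=\frac{1}{4\|\rho\|_{\mathrm{F}}^2}\int_G\big\|[U(g),\rho]\big\|_{\mathrm{F}}^2\,dg,$$ where $dg$ is the normalized Haar measure (total mass $1$). Here $G=\mathbb{SU}(2)\times\cdots\times\mathbb{SU}(2)$ ($N$ factors, denoted $\mathbb{SU}(2)^{\otimes N}$), and the element $(R_1,\dots,R_N)$ acts on $(\mathbb{C}^2)^{\otimes N}$ by $R_1\otimes\cdots\otimes R_N$, where the $R_j\in\mathbb{SU}(2)$ are integrated independently, each with respect to the normalized Haar measure of $\mathbb{SU}(2)$. With $d=2^N$ and $\rho_\star=\mathbb{I}_d/d$, the coherence measure is $\mathcal{C}(\rho)=\sqrt{\frac{d}{d-1}}\,\|\rho-\rho_\star\|_{\mathrm{F}}$,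 and the Brukner-Zeilinger information is $\mathcal{I}_{BZ}(\rho)=\mathrm{Tr}\rho^2-\frac1d$. *)

(* Defs.v *)
From HB Require Import structures.
From mathcomp Require Import all_boot all_order all_algebra all_fingroup.
From mathcomp Require Import sesquilinear spectral.
From mathcomp Require Import all_classical all_reals all_analysis.
From mathcomp Require Import complex mxtens.

Set Implicit Arguments.
Unset Strict Implicit.
Unset Printing Implicit Defensive.

Import Order.TTheory GRing.Theory Num.Theory.
Import numFieldNormedType.Exports.

Local Open Scope classical_set_scope.
Local Open Scope ring_scope.
Local Open Scope sesquilinear_scope.
Local Open Scope complex_scope.

Section matrices.
Variable R : realType.

Definition commx n (A B : 'M[R[i]]_n) : 'M[R[i]]_n := A *m B - B *m A.

(* The trace below is a nonnegative real, so taking its real part only changes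
   its type. *)
Definition frobenius n (A : 'M[R[i]]_n) : R :=
  Num.sqrt (complex.Re (\tr (A ^t* *m A))).

Definition psdmx n (A : 'M[R[i]]_n) : Prop :=
  A \is hermsymmx /\ forall v : 'cV[R[i]]_n, 0 <= (v ^t* *m A *m v) 0 0.

Definition density_mx n (rho : 'M[R[i]]_n) : Prop := psdmx rho /\ \tr rho = 1.

Definition coherence d (rho : 'M[R[i]]_d) : R :=
  Num.sqrt (d%:R / (d%:R - 1)) * frobenius (rho - (d%:R^-1)%:M).

Definition bz_information d (rho : 'M[R[i]]_d) : R[i] :=
  \tr (rho *m rho) - d%:R^-1.

(* A 0 *t A 1 *t ... *t A n.-1, with the leftmost factor acting on the most
   significant index; the cast is along 2 ^ n.+1 = 2 * 2 ^ n. *)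
Fixpoint tensor_qubits n : ('I_n -> 'M[R[i]]_2) -> 'M[R[i]]_(2 ^ n) :=
  match n with
  | 0 => fun _ => 1%:M
  | m.+1 => fun A =>
      castmx (esym (expnS 2 m), esym (expnS 2 m))
        (A ord0 *t tensor_qubits (fun i => A (lift ord0 i)))
  end.

End matrices.

Section special_unitary.
Variable R : realType.

Record SU2 := MkSU2 {
  su2val :> 'M[R[i]]_2 ;
  su2valP : (su2val \is unitarymx) && (\det su2val == 1) }.

HB.instance Definition _ := [isSub for su2val].
HB.instance Definition _ := [Choice of SU2 by <:].

Fact su2_one_subproof :
  ((1%:M : 'M[R[i]]_2) \is unitarymx) && (\det (1%:M : 'M[R[i]]_2) == 1).
Proof. by rewrite det1 eqxx andbT; apply/unitarymxP; rewrite trmx1 map_mx1 mulmx1. Qed.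

Fact su2_mul_subproof (U V : SU2) :
  ((su2val U *m su2val V) \is unitarymx) && (\det (su2val U *m su2val V) == 1).
Proof.
case: U V => [U /= /andP[uU /eqP dU]] [V /= /andP[uV /eqP dV]].
by rewrite det_mulmx dU dV mulr1 eqxx mul_unitarymx.
Qed.

Fact su2_inv_subproof (U : SU2) :
  ((su2val U) ^t* \is unitarymx) && (\det ((su2val U) ^t*) == 1).
Proof.
case: U => [U /= /andP[uU /eqP dU]].
by rewrite trmxC_unitary uU det_map_mx det_tr dU rmorph1 eqxx.
Qed.

Definition su2_one : SU2 := MkSU2 su2_one_subproof.
Definition su2_mul (U V : SU2) : SU2 := MkSU2 (su2_mul_subproof U V).
Definition su2_inv (U : SU2) : SU2 := MkSU2 (su2_inv_subproof U).

Fact su2_mulA : associative su2_mul.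
Proof. by move=> U V W; apply: val_inj; rewrite /= mulmxA. Qed.
Fact su2_mul1 : left_id su2_one su2_mul.
Proof. by move=> U; apply: val_inj; rewrite /= mul1mx. Qed.
Fact su2_mulr1 : right_id su2_one su2_mul.
Proof. by move=> U; apply: val_inj; rewrite /= mulmx1. Qed.
Fact su2_mulrV : right_inverse su2_one su2_inv su2_mul.
Proof.
move=> U; apply: val_inj => /=.
by case: U => [U /= /andP[/unitarymxP uU _]].
Qed.
Fact su2_mulV : left_inverse su2_one su2_inv su2_mul.
Proof.
by move=> U; apply: val_inj; apply/mulmx1C; exact: (congr1 su2val (su2_mulrV U)).
Qed.

HB.instance Definition _ := isPointed.Build SU2 su2_one.
HB.instance Definition _ :=
  isGroup.Build SU2 su2_mulA su2_mul1 su2_mulr1 su2_mulV su2_mulrV.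

(* R[i]^o carries the topology of the complex modulus, which R[i] itself is not
   declared with. *)
Definition su2_incl (U : SU2) : 'M[R[i]^o]_2 := su2val U.

HB.instance Definition _ := Topological.copy SU2 (initial_topology su2_incl).

Definition su2_borel : set (set SU2) := <<s @open SU2 >>.

HB.instance Definition _ := @isMeasurable.Build
  (sigma_display (@open SU2)) SU2 su2_borel
  (@sigma_algebra0 _ setT (@open SU2)) (@sigma_algebraC _ (@open SU2))
  (@sigma_algebra_bigcup _ setT (@open SU2)).

End special_unitary.

(* Left invariance: with total mass 1 it singles out the normalized Haar
   measure of the compact group SU(2). *)
Definition su2_haar (R : realType) (mu : probability (SU2 R) R) : Prop :=
  forall (g : SU2 R) (A : set (SU2 R)), measurable A ->
    mu [set (g * x)%g | x in A] = mu A.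

Section power_probability.
Context d (T : measurableType d) (R : realType) (P : probability T R).

Definition tuple_cons n (x : T * n.-tuple T) : n.+1.-tuple T :=
  [tuple of x.1 :: x.2].

Fact measurable_tuple_cons n : measurable_fun [set: T * n.-tuple T] (@tuple_cons n).
Proof. exact: measurable_cons measurable_fst measurable_snd. Qed.

HB.instance Definition _ n := isMeasurableFun.Build _ _ _ _
  (@tuple_cons n) (@measurable_tuple_cons n).

(* The product probability P \x ... \x P on n-tuples: n.+1.-tuple T is
   identified with T * n.-tuple T. *)
Fixpoint power_prob n : probability (n.-tuple T) R :=
  match n with
  | 0 => dirac [tuple]
  | m.+1 => distribution (P \x power_prob m)%E (@tuple_cons m)
  end.

End power_probability.

(* G is the group with its normalized Haar measure mu, U its representation. *)
Definition asymmetry (R : realType) d (G : measurableType d)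
    (mu : probability G R) n (U : G -> 'M[R[i]]_n) (rho : 'M[R[i]]_n) : R :=
  (4 * frobenius rho ^+ 2)^-1 *
    \int[mu]_(g in setT) (frobenius (commx (U g) rho) ^+ 2).

Definition local_unitary (R : realType) N (g : N.-tuple (SU2 R)) :
  'M[R[i]]_(2 ^ N) := tensor_qubits (fun i => su2val (tnth g i)).

(* Main.v *)
Require Import Defs.
From mathcomp Require Import all_boot all_order all_algebra all_fingroup.
From mathcomp Require Import sesquilinear spectral.
From mathcomp Require Import all_classical all_reals all_analysis.
From mathcomp Require Import measurable_realfun complex mxtens.
From mathcomp Require Import ring.

(** For unitary U and hermitian rho,
    |[U, rho]|^2 = 2 Tr rho^2 - 2 Tr (U^* rho U rho).
    By left invariance the integrand may be averaged over the left translates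
    of U by the 4^N tensor products of the quaternions 1, i, j, k. These form a
    unitary 1-design: the average of h^* rho h is Tr rho / 2^N times the
    identity. The averaged integrand is therefore the constant
    2 Tr rho^2 - 2 / 2^N, and no Haar integral has to be computed. *)

Set Implicit Arguments.
Unset Strict Implicit.
Unset Printing Implicit Defensive.

Import Order.TTheory GRing.Theory Num.Theory.
Import numFieldNormedType.Exports.
Local Open Scope classical_set_scope.
Local Open Scope ring_scope.
Local Open Scope sesquilinear_scope.
Local Open Scope complex_scope.

(** * Continuity of matrix-valued maps, entry by entry *)

(** Neighbourhoods of a matrix are generated by boxes of entry neighbourhoods; as there are finitely
    many entries, the entrywise conditions can be intersected. *)
Lemma mx_continuousP (S T : topologicalType) m n (f : S -> 'M[T]_(m, n)) :
  continuous f <-> forall i j, continuous (fun x => f x i j).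
Proof.
split=> [cf i j x A /= xA|cf x A [P xP PA]].
  apply: (cf x (fun M => A (M i j))).
  exists (fun i' j' => if (i' == i) && (j' == j) then A else setT).
    by move=> i' j'; case: ifP => [/andP[/eqP-> /eqP->]//|_]; exact: filterT.
  by move=> M /(_ i j); rewrite !eqxx.
have xfP : \forall y \near x, forall i j, P i j (f y i j).
  apply: filter_forall => i; apply: filter_forall => j.
  exact: (cf i j x _ (xP i j)).
by apply: filterS xfP => y fyP; exact: PA.
Qed.

Lemma sum2E (V : nmodType) (F : 'I_2 -> V) : \sum_i F i = F 0 + F 1.
Proof.
by rewrite !big_ord_recl big_ord0 addr0; congr (_ + F _); apply/val_inj.
Qed.

Lemma continuous_lincomb (K : numFieldType) (T : topologicalType)
    (V : normedModType K) (a b : K) (f g : T -> V) :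
  continuous f -> continuous g -> continuous (fun x => a *: f x + b *: g x).
Proof.
by move=> cf cg x; apply: cvgD; apply: cvgZl_tmp; [exact: cf|exact: cg].
Qed.

(** * Continuity and Borel measurability on SU(2) *)

Section SU2_measurable.
Variable R : realType.

Lemma su2_entry_continuous i j :
  continuous ((fun U => su2_incl U i j) : SU2 R -> R[i]^o).
Proof.
have c : continuous (@su2_incl R : SU2 R -> 'M[R[i]^o]_2).
  exact: (@initial_continuous _ _ (@su2_incl R)).
exact: ((mx_continuousP (T := R[i]^o) (@su2_incl R)).1 c i j).
Qed.

(** Each entry of [g * U] is a fixed linear combination of entries of [U], and the initial topology
    reduces continuity to the entries. *)
Lemma su2_mul_continuous (g : SU2 R) : continuous (fun U : SU2 R => (g * U)%g).
Proof.
have cE i j : continuous ((fun U => su2_incl (g * U)%g i j) : SU2 R -> R[i]^o).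
  have gE : (fun U : SU2 R => su2_incl (g * U)%g i j) = (fun U : SU2 R =>
      su2val g i 0 *: su2_incl U 0 j + su2val g i 1 *: su2_incl U 1 j).
    by apply/funext => U; rewrite {1}/su2_incl /= mxE sum2E.
  have := @continuous_lincomb R[i] (SU2 R) R[i]^o (su2val g i 0) (su2val g i 1)
    _ _ (@su2_entry_continuous 0 j) (@su2_entry_continuous 1 j).
  by rewrite -gE.
apply: (@continuous_comp_initial _ _ _ (@su2_incl R)).
exact: ((mx_continuousP (T := R[i]^o) _).2 cE).
Qed.

Lemma lipschitz1_continuous (f : R[i]^o -> R) :
  (forall x y : R[i], `|f x - f y|%:C <= `|x - y|) -> continuous f.
Proof.
move=> flip; apply/continuousP => A oA; rewrite openE => z /= Az.
have /nbhs_ballP[e /= e0 eA] := open_nbhs_nbhs (conj oA Az).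
(* Balls of [R[i]^o] have radii in [R[i]], hence the embedded radius [e%:C]. *)
apply: (@filterS _ (nbhs (z : R[i]^o)) _ (ball (z : R[i]^o) e%:C)); last first.
  by apply: nbhsx_ballx; rewrite ltcR.
move=> y; rewrite -ball_normE /= => zy; apply: eA; rewrite -ball_normE /=.
by rewrite -ltcR (le_lt_trans (flip _ _)).
Qed.

Lemma complex_Re_continuous : continuous (@complex.Re R : R[i]^o -> R).
Proof.
by apply: lipschitz1_continuous => x y; rewrite -raddfB normc_ge_Re.
Qed.

Lemma complex_Im_continuous : continuous (@complex.Im R : R[i]^o -> R).
Proof.
(* Up to sign, [Im] is [Re] after multiplication by ['i], which preserves the modulus. *)
apply: lipschitz1_continuous => x y; rewrite -raddfB /= -normrN -ReiNIm.
by rewrite (le_trans (normc_ge_Re _))// normrM complexiE normCi mulr1.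
Qed.

Lemma su2_continuous_measurable (f : SU2 R -> R) :
  continuous f -> measurable_fun setT f.
Proof.
move=> /continuousP cf; apply: (measurability _ (RGenOpens.measurableE R)).
move=> _ [_ [a [b ->] <-]]; rewrite setTI; apply: sub_sigma_algebra.
exact/cf/interval_open.
Qed.

Lemma su2_mul_measurable (g : SU2 R) :
  measurable_fun setT (fun U : SU2 R => (g * U)%g).
Proof.
apply: (@measurability _ _ _ _ _ _ (@open (SU2 R))) => //.
move=> _ [A oA <-]; rewrite setTI; apply: sub_sigma_algebra.
by move/continuousP : (su2_mul_continuous (g := g)); exact.
Qed.
End SU2_measurable.

(** * Translation invariance of integrals over SU(2) and its powers *)

Section haar_integral.
Context (R : realType) (mu : probability (SU2 R) R) (mu_haar : su2_haar mu).
Local Open Scope ereal_scope.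

(** The preimage of [A] under translation by [g] is its image under translation by [g^-1], to which
    [su2_haar] applies. *)
Lemma su2_haar_pushforward (g : SU2 R) (A : set (SU2 R)) : measurable A ->
  pushforward mu (fun U : SU2 R => (g * U)%g) A = mu A.
Proof.
move=> mA; rewrite /pushforward -(mu_haar g^-1%g mA); congr (mu _).
apply/seteqP; split=> U /=.
  by move=> AgU; exists (g * U)%g => //; rewrite mulgA mulVg mul1g.
by move=> [V AV <-]; rewrite mulgA mulgV mul1g.
Qed.

Lemma su2_haar_integral (g : SU2 R) (f : SU2 R -> \bar R) :
  measurable_fun setT f -> (forall U, 0 <= f U) ->
  \int[mu]_U f (g * U)%g = \int[mu]_U f U.
Proof.
move=> mf f0; have := ge0_integral_pushforward (su2_mul_measurable g) mu
  measurableT mf (fun U _ => f0 U).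
rewrite preimage_setT => <-.
apply: eq_measure_integral => [|? A mA _]; first exact: su2_mul_measurable.
exact: su2_haar_pushforward.
Qed.

Definition tuple_mul n (h g : n.-tuple (SU2 R)) : n.-tuple (SU2 R) :=
  [tuple (tnth h i * tnth g i)%g | i < n].

Lemma tuple_mul_measurable n (h : n.-tuple (SU2 R)) :
  measurable_fun setT (tuple_mul h).
Proof.
apply/measurable_fun_tnthP => i.
rewrite (_ : _ \o _ = fun g => (tnth h i * tnth g i)%g); last first.
  by apply/funext => g /=; rewrite tnth_mktuple.
by apply: measurableT_comp (su2_mul_measurable _) _; exact: measurable_tnth.
Qed.

Lemma tuple_mul_cons n x y (h g : n.-tuple (SU2 R)) :
  tuple_mul (tuple_cons (x, h)) (tuple_cons (y, g)) =
  tuple_cons ((x * y)%g, tuple_mul h g).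
Proof.
apply: eq_from_tnth => i; rewrite tnth_mktuple.
by case: (unliftP ord0 i) => [j|] -> /=; rewrite ?tnth0 // !tnthS tnth_mktuple.
Qed.

Lemma tuple_consP n (h : n.+1.-tuple (SU2 R)) :
  exists x t, h = tuple_cons (x, t).
Proof. by case/tupleP: h => x t; exists x, t; apply: val_inj. Qed.

(** Induction with Tonelli: for a fixed head, the induction hypothesis removes the translation of
    the tail from the inner integral; invariance of [mu] then removes that of the head from the
    outer one. *)
Lemma power_haar_integral n (h : n.-tuple (SU2 R))
    (f : n.-tuple (SU2 R) -> \bar R) :
  measurable_fun setT f -> (forall t, 0 <= f t) ->
  \int[power_prob mu n]_t f (tuple_mul h t) = \int[power_prob mu n]_t f t.
Proof.
elim: n => [|n IHn] in h f *.
  move=> mf f0; apply: eq_integral => t _; congr f.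
  exact: etrans (tuple0 _) (esym (tuple0 _)).
move=> mf f0; have [x [s ->]] := tuple_consP h.
have mcons := @measurable_tuple_cons _ (SU2 R) n.
have mfc : measurable_fun setT (f \o @tuple_cons _ (SU2 R) n).
  exact: measurableT_comp.
have mfm : measurable_fun setT (f \o tuple_mul (tuple_cons (x, s))).
  by apply: measurableT_comp mf _; exact: tuple_mul_measurable.
rewrite /= !ge0_integral_distribution//=.
rewrite fubini_tonelli1//=; last exact: (measurableT_comp mfm).
rewrite /fubini_F /=.
transitivity (\int[mu]_y \int[power_prob mu n]_t f (tuple_cons ((x * y)%g, t))).
  apply: eq_integral => y _; under eq_integral do rewrite tuple_mul_cons.
  apply: (IHn s (fun t => f (tuple_cons ((x * y)%g, t)))) => //.
  exact: (measurableT_comp mfc (measurable_pair1 _)).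
rewrite (su2_haar_integral x
  (f := fun y => \int[power_prob mu n]_t f (tuple_cons (y, t)))).
- by rewrite fubini_tonelli1.
- apply: (@measurable_fun_fubini_tonelli_F _ _ _ _ _ (power_prob mu n) _ mfc).
  by move=> z; exact: f0.
- by move=> U; apply: integral_ge0.
Qed.

End haar_integral.

(** * Measurability of complex and matrix-valued functions *)

Section complex_measurable.
Context d (T : measurableType d) (R : realType).
Implicit Types f g : T -> R[i].

(** The two real coordinates are enough here, because the integrand is a real polynomial in the real
    and imaginary parts of matrix entries. *)
Definition cmeasurable f :=
  measurable_fun setT (fun x => complex.Re (f x)) /\
  measurable_fun setT (fun x => complex.Im (f x)).

Lemma cmeasurable_cst z : cmeasurable (fun=> z).
Proof. by split; exact: measurable_cst. Qed.

Lemma cmeasurableD f g :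
  cmeasurable f -> cmeasurable g -> cmeasurable (fun x => f x + g x).
Proof.
move=> [mf nf] [mg ng]; split.
  rewrite (_ : (fun _ => _) = fun x => complex.Re (f x) + complex.Re (g x)).
    exact: measurable_funD.
  by apply/funext => x; rewrite raddfD.
rewrite (_ : (fun _ => _) = fun x => complex.Im (f x) + complex.Im (g x)).
  exact: measurable_funD.
by apply/funext => x; rewrite raddfD.
Qed.

Lemma cmeasurableM f g :
  cmeasurable f -> cmeasurable g -> cmeasurable (fun x => f x * g x).
Proof.
move=> [mf nf] [mg ng]; split.
  rewrite (_ : (fun _ => _) = fun x => complex.Re (f x) * complex.Re (g x)
      - complex.Im (f x) * complex.Im (g x)).
    by apply: measurable_funB; exact: measurable_funM.
  by apply/funext => x; case: (f x) (g x) => [a b] [].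
rewrite (_ : (fun _ => _) = fun x => complex.Re (f x) * complex.Im (g x)
    + complex.Im (f x) * complex.Re (g x)).
  by apply: measurable_funD; exact: measurable_funM.
by apply/funext => x; case: (f x) (g x) => [a b] [].
Qed.

Lemma cmeasurable_sum (I : Type) (r : seq I) (F : I -> T -> R[i]) :
  (forall i, cmeasurable (F i)) -> cmeasurable (fun x => \sum_(i <- r) F i x).
Proof.
move=> mF; elim: r => [|i r IHr].
  by under eq_fun do rewrite big_nil; exact: cmeasurable_cst.
by under eq_fun do rewrite big_cons; exact: cmeasurableD.
Qed.

Definition mx_measurable m n (A : T -> 'M[R[i]]_(m, n)) :=
  forall i j, cmeasurable (fun x => A x i j).

Lemma mx_measurable_cst m n (A : 'M[R[i]]_(m, n)) : mx_measurable (fun=> A).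
Proof. by move=> i j; exact: cmeasurable_cst. Qed.

Lemma mx_measurableM m n p (A : T -> 'M[R[i]]_(m, n))
    (B : T -> 'M[R[i]]_(n, p)) :
  mx_measurable A -> mx_measurable B -> mx_measurable (fun x => A x *m B x).
Proof.
move=> mA mB i j; under eq_fun do rewrite mxE.
by apply: cmeasurable_sum => k; exact: cmeasurableM.
Qed.

Lemma mx_measurableB m n (A B : T -> 'M[R[i]]_(m, n)) :
  mx_measurable A -> mx_measurable B -> mx_measurable (fun x => A x - B x).
Proof.
move=> mA mB i j; under eq_fun do rewrite !mxE -mulN1r.
by apply: cmeasurableD => //; apply: cmeasurableM => //; exact: cmeasurable_cst.
Qed.

Lemma mx_measurable_tensor N (A : 'I_N -> T -> 'M[R[i]]_2) :
  (forall i, mx_measurable (A i)) ->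
  mx_measurable (fun x => tensor_qubits (fun i => A i x)).
Proof.
elim: N => [|N IHN] in A *; move=> mA i j /=; first exact: cmeasurable_cst.
under eq_fun do rewrite castmxE !mxE.
apply: cmeasurableM; first exact: mA.
exact: (IHN (fun i => A (lift ord0 i))).
Qed.

End complex_measurable.

Lemma su2_entry_measurable (R : realType) i j :
  cmeasurable (fun U : SU2 R => su2val U i j).
Proof.
have c := @su2_entry_continuous R i j.
split; apply: su2_continuous_measurable => U.
  exact: (continuous_comp (c U) (@complex_Re_continuous R _)).
exact: (continuous_comp (c U) (@complex_Im_continuous R _)).
Qed.

Lemma local_unitary_measurable (R : realType) N :
  mx_measurable (@local_unitary R N).
Proof.
apply: (mx_measurable_tensor (A := fun i g => su2val (tnth g i))) => i j k.
have mt := @measurable_tnth _ (SU2 R) N i.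
by have [mR mI] := su2_entry_measurable R j k; split;
  [exact: (measurableT_comp mR mt)|exact: (measurableT_comp mI mt)].
Qed.

(** * Algebra of tensor products of qubit matrices *)

Lemma mul_castmx (R : pzRingType) m n p m' n' p' (em : m = m') (en : n = n')
    (ep : p = p') (A : 'M[R]_(m, n)) (B : 'M[R]_(n, p)) :
  castmx (em, en) A *m castmx (en, ep) B = castmx (em, ep) (A *m B).
Proof. by case: m' / em; case: n' / en; case: p' / ep. Qed.

Lemma castmx1 (R : pzRingType) m n (e : m = n) :
  castmx (e, e) (1%:M : 'M[R]_m) = 1%:M.
Proof. by case: n / e. Qed.

Lemma tens1mx (R : comPzRingType) m n :
  (1%:M : 'M[R]_m) *t (1%:M : 'M[R]_n) = 1%:M.
Proof.
apply/matrixP => i j; rewrite !mxE -natrM mulnb.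
by rewrite -(can_eq (@mxtens_unindexK m n)).
Qed.

Section tensor_qubits.
Variable R : realType.
Implicit Types A B : 'M[R[i]]_2.

Lemma tensor_qubitsM N (A B : 'I_N -> 'M[R[i]]_2) :
  tensor_qubits A *m tensor_qubits B = tensor_qubits (fun i => A i *m B i).
Proof.
elim: N => [|N IHN] /= in A B *; first by rewrite mulmx1.
by rewrite mul_castmx tensmx_mul IHN.
Qed.

Lemma tensor_qubits_adj N (A : 'I_N -> 'M[R[i]]_2) :
  (tensor_qubits A)^t* = tensor_qubits (fun i => (A i)^t*).
Proof.
elim: N => [|N IHN] /= in A *; first by rewrite trmx1 map_mx1.
by rewrite trmx_cast map_castmx trmx_tens map_mxT -IHN.
Qed.

Lemma tensor_qubits1 N :
  tensor_qubits (fun _ : 'I_N => 1%:M) = 1%:M :> 'M[R[i]]_(2 ^ N).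
Proof. by elim: N => [|N IHN] //=; rewrite IHN tens1mx castmx1. Qed.

(** Turns translation of the integration variable into multiplication of unitaries, so that the
    design acts inside the integrand. *)
Lemma local_unitaryM N (h g : N.-tuple (SU2 R)) :
  local_unitary (tuple_mul h g) = local_unitary h *m local_unitary g.
Proof.
rewrite tensor_qubitsM; congr tensor_qubits; apply/funext => i.
by rewrite tnth_mktuple.
Qed.

Lemma local_unitary_unitary N (g : N.-tuple (SU2 R)) :
  local_unitary g \is unitarymx.
Proof.
apply/unitarymxP; rewrite tensor_qubits_adj tensor_qubitsM.
rewrite -[RHS]tensor_qubits1; congr tensor_qubits; apply/funext => i.
by have /andP[/unitarymxP] := su2valP (tnth g i).
Qed.

Lemma local_unitary_cons N x (t : N.-tuple (SU2 R)) :
  local_unitary (tuple_cons (x, t)) =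
  castmx (esym (expnS 2 N), esym (expnS 2 N)) (su2val x *t local_unitary t).
Proof.
rewrite /local_unitary /= tnth0; congr (castmx _ (_ *t tensor_qubits _)).
by apply/funext => i; rewrite tnthS.
Qed.

End tensor_qubits.

(** * The quaternion 1-design on one qubit and on N qubits *)

Section quaternions.
Variable R : realType.

Definition mx2 (a b c d : R[i]) : 'M[R[i]]_2 :=
  \matrix_(i, j) if i == 0 then if j == 0 then a else b
                 else if j == 0 then c else d.

Lemma ord2P (i : 'I_2) : i = 0 \/ i = 1.
Proof. by case: i => [[|[|//]]] ltn; [left|right]; apply: val_inj. Qed.

Lemma det_mx22 (K : comPzRingType) (A : 'M[K]_2) :
  \det A = A 0 0 * A 1 1 - A 0 1 * A 1 0.
Proof.
rewrite (expand_det_row _ 0) sum2E /cofactor !det_mx11 !mxE /= expr0 expr1.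
rewrite mul1r mulN1r mulrN; congr (_ * A _ _ - _ * A _ _); exact: val_inj.
Qed.

(** This is the complex matrix of the quaternion a + bj; the hypothesis says that it has norm 1. *)
Fact mx2_su2 (a b : R[i]) : a * a^*%C + b * b^*%C = 1 ->
  (mx2 a b (- b^*%C) a^*%C \is unitarymx) &&
  (\det (mx2 a b (- b^*%C) a^*%C) == 1).
Proof.
move=> ab1; apply/andP; split; last first.
  by rewrite det_mx22; apply/eqP; rewrite !mxE /= -ab1; ring.
apply/unitarymxP/matrixP => i j; rewrite !mxE sum2E !mxE.
(* The generic conjugation and that of [R[i]] are convertible; a single form lets the
   simplifications fire. *)
have conjE (z : R[i]) : z^*%R = z^*%C by [].
by have [->|->] := ord2P i; have [->|->] := ord2P j;
  rewrite !conjE /= ?rmorphN /= ?conjcK -?ab1; ring.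
Qed.

Fact quat_1_norm : 1 * 1^*%C + 0 * 0^*%C = 1 :> R[i].
Proof. by rewrite rmorph1 mulr1 mul0r addr0. Qed.
Fact quat_i_norm : 'i * 'i^*%C + 0 * 0^*%C = 1 :> R[i].
Proof. by rewrite mul0r addr0; simpc. Qed.
Fact quat_j_norm : 0 * 0^*%C + 1 * 1^*%C = 1 :> R[i].
Proof. by rewrite rmorph1 mulr1 mul0r add0r. Qed.
Fact quat_k_norm : 0 * 0^*%C + 'i * 'i^*%C = 1 :> R[i].
Proof. by rewrite mul0r add0r; simpc. Qed.

(** In order: the identity, then the Pauli matrices Z, Y, X, each multiplied by ['i] to have
    determinant 1. *)
Definition quaternions : seq (SU2 R) :=
  [:: MkSU2 (mx2_su2 quat_1_norm); MkSU2 (mx2_su2 quat_i_norm);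
      MkSU2 (mx2_su2 quat_j_norm); MkSU2 (mx2_su2 quat_k_norm)].

(** Completeness relation of an orthogonal basis of the 2 x 2 matrices whose elements have squared
    Frobenius norm 2; it is checked on the sixteen choices of indices. *)
Lemma quaternions_ortho a b c d :
  \sum_(q <- quaternions) (su2val q a b)^* * su2val q c d =
  2 * ((a == c) && (b == d))%:R.
Proof.
rewrite !big_cons big_nil !mxE.
have conjE (z : R[i]) : z^*%R = z^*%C by [].
have [->|->] := ord2P a; have [->|->] := ord2P b; have [->|->] := ord2P c;
have [->|->] := ord2P d; rewrite !conjE /=; simpc; by rewrite ?addNr.
Qed.
End quaternions.

Section quaternion_tuples.
Variable R : realType.

Fixpoint quaternion_tuples N : seq (N.-tuple (SU2 R)) :=
  match N with
  | 0 => [:: [tuple]]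
  | n.+1 =>
    [seq tuple_cons (q, h) | q <- quaternions R, h <- quaternion_tuples n]
  end.

Lemma size_quaternion_tuples N : size (quaternion_tuples N) = (4 ^ N)%N.
Proof. by elim: N => // N IHN; rewrite expnS -IHN; exact: size_allpairs. Qed.

(** Entries of a tensor product factor, so the sum splits into the one-qubit relation, worth 2,
    times the relation for the remaining qubits. *)
Lemma quaternion_tuples_ortho N a b c d :
  \sum_(h <- quaternion_tuples N)
    (local_unitary h a b)^* * local_unitary h c d =
  2 ^+ N * ((a == c) && (b == d))%:R.
Proof.
elim: N => [|N IHN] in a b c d *.
  rewrite big_seq1 !mxE [a]ord1 [b]ord1 [c]ord1 [d]ord1 !eqxx.
  by rewrite rmorph1 mulr1.
rewrite big_allpairs_dep /=.
(* The double [esym] is the form that [castmxE] produces. Below, [u] splits an index into that of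
   the first qubit and that of the others. *)
set e := esym (esym (expnS 2 N)).
pose u (i : 'I_(2 ^ N.+1)) := mxtens_unindex (cast_ord e i).
have uE i j : (i == j) = ((u i).1 == (u j).1) && ((u i).2 == (u j).2).
  by rewrite -xpair_eqE -!surjective_pairing (can_eq (@mxtens_unindexK _ _))
    (inj_eq (@cast_ord_inj _ _ e)).
transitivity (\sum_(q <- quaternions R) \sum_(h <- quaternion_tuples N)
    ((su2val q (u a).1 (u b).1)^* * su2val q (u c).1 (u d).1) *
    ((local_unitary h (u a).2 (u b).2)^* * local_unitary h (u c).2 (u d).2)).
  apply: eq_bigr => q _; apply: eq_bigr => h _.
  by rewrite local_unitary_cons !castmxE !mxE rmorphM mulrACA.
under eq_bigr do rewrite -mulr_sumr IHN.
rewrite -mulr_suml quaternions_ortho !uE mulrACA -exprS -natrM mulnb.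
by rewrite andbACA.
Qed.

(** In entry (b, d), orthogonality keeps only the terms with a = c and forces b = d, which leaves
    the trace. Dividing by the 4^N tuples gives the 1-design property. *)
Lemma quaternion_twirl N (X : 'M[R[i]]_(2 ^ N)) :
  \sum_(h <- quaternion_tuples N)
    (local_unitary h)^t* *m X *m local_unitary h = (2 ^+ N * \tr X)%:M.
Proof.
apply/matrixP => b d; rewrite summxE !mxE.
transitivity (\sum_c \sum_a \sum_(h <- quaternion_tuples N)
   X a c * ((local_unitary h a b)^* * local_unitary h c d)).
  under [RHS]eq_bigr do rewrite exchange_big /=.
  rewrite [RHS]exchange_big /=; apply: eq_bigr => h _.
  rewrite mxE; apply: eq_bigr => c _; rewrite mxE mulr_suml.
  by apply: eq_bigr => a _; rewrite !mxE mulrCA mulrA.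
under eq_bigr do under eq_bigr do rewrite -mulr_sumr quaternion_tuples_ortho.
rewrite /mxtrace mulr_sumr -sumrMnl; apply: eq_bigr => c _.
rewrite (bigD1 c)//= big1 ?addr0 => [|a /negbTE ->].
  by rewrite eqxx /= mulrCA mulrA mulr_natr.
by rewrite mulr0 mulr0.
Qed.

End quaternion_tuples.

(** * Frobenius norm of commutators with unitaries *)

Section frobenius.
Variable R : realType.

(** The trace is a sum of squared moduli, hence real and nonnegative; definiteness and measurability
    of the norm are both read off this form. *)
Lemma frobenius_sum n (A : 'M[R[i]]_n) :
  \tr (A^t* *m A) = (\sum_i \sum_j
    (complex.Re (A i j) ^+ 2 + complex.Im (A i j) ^+ 2))%:C.
Proof.
rewrite rmorph_sum /mxtrace; under eq_bigr do rewrite mxE.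
rewrite exchange_big /=; apply: eq_bigr => i _; rewrite rmorph_sum.
apply: eq_bigr => j _; rewrite !mxE mulrC.
exact: etrans (esym (sqr_normc _)) (esym (add_Re2_Im2 _)).
Qed.

Lemma frobenius_sqr n (A : 'M[R[i]]_n) :
  frobenius A ^+ 2 = \sum_i \sum_j
    (complex.Re (A i j) ^+ 2 + complex.Im (A i j) ^+ 2).
Proof.
rewrite /frobenius frobenius_sum /= sqr_sqrtr//.
by apply: sumr_ge0 => i _; apply: sumr_ge0 => j _; rewrite addr_ge0// sqr_ge0.
Qed.

Lemma frobenius_sqr_trace n (A : 'M[R[i]]_n) :
  (frobenius A ^+ 2)%:C = \tr (A^t* *m A).
Proof. by rewrite frobenius_sqr frobenius_sum. Qed.

Lemma frobenius_sqr_eq0 n (A : 'M[R[i]]_n) : frobenius A ^+ 2 = 0 -> A = 0.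
Proof.
rewrite frobenius_sqr => /eqP A0; apply/matrixP => i j; rewrite mxE.
have ge0 k l : 0 <= complex.Re (A k l) ^+ 2 + complex.Im (A k l) ^+ 2.
  by rewrite addr_ge0// sqr_ge0.
move: A0; rewrite psumr_eq0; last by move=> k _; exact: sumr_ge0.
move=> /allP/(_ i); rewrite mem_index_enum psumr_eq0//.
move=> /(_ isT)/allP/(_ j); rewrite mem_index_enum => /(_ isT) /=.
rewrite paddr_eq0 ?sqr_ge0// !sqrf_eq0 => /andP[/eqP re0 /eqP im0].
by apply/eqP; rewrite eq_complex re0 im0 !eqxx.
Qed.

Lemma hermsymmx_adj n (A : 'M[R[i]]_n) : A \is hermsymmx -> A^t* = A.
Proof. by move=> /is_hermitianmxP; rewrite expr0 scale1r => <-. Qed.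

(** Of the four terms of the expanded trace, unitarity reduces two to Tr A^2, and cyclicity
    identifies the other two. *)
Lemma frobenius_commx n (U A : 'M[R[i]]_n) :
  U \is unitarymx -> A \is hermsymmx ->
  (frobenius (commx U A) ^+ 2)%:C =
  2 * \tr (A *m A) - 2 * \tr (U^t* *m A *m U *m A).
Proof.
move=> /unitarymxP UV /hermsymmx_adj AH; have VU := mulmx1C UV.
have adjB : (commx U A)^t* = A *m U^t* - U^t* *m A.
  have -> : (commx U A)^T = A^T *m U^T - U^T *m A^T.
    by rewrite /commx raddfB /= !trmx_mul.
  by rewrite map_mxB !map_mxM AH.
rewrite frobenius_sqr_trace adjB /commx.
rewrite mulmxBl !mulmxBr !raddfB /=.
have -> : \tr (A *m U^t* *m (U *m A)) = \tr (A *m A).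
  by rewrite -mulmxA (mulmxA _ U) VU mul1mx.
have -> : \tr (U^t* *m A *m (A *m U)) = \tr (A *m A).
  by rewrite -mulmxA mxtrace_mulC -!mulmxA UV mulmx1.
have -> : \tr (A *m U^t* *m (A *m U)) = \tr (U^t* *m A *m U *m A).
  by rewrite -mulmxA mxtrace_mulC !mulmxA.
by rewrite !mulmxA; ring.
Qed.

(** With [U] the unitary of [g], the cross term sums to [U^t*] times the twirl of [A] times [U]. The
    twirl is scalar, so [U] cancels and the result is independent of [g]. *)
Lemma frobenius_commx_mean N (A : 'M[R[i]]_(2 ^ N)) (g : N.-tuple (SU2 R)) :
  A \is hermsymmx ->
  \sum_(h <- quaternion_tuples R N)
     (frobenius (commx (local_unitary (tuple_mul h g)) A) ^+ 2)%:C =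
  4 ^+ N * (2 * \tr (A *m A) - 2 * \tr A ^+ 2 / 2 ^+ N).
Proof.
move=> AH; have /unitarymxP UV := local_unitary_unitary g.
have VU := mulmx1C UV; set U := local_unitary g.
transitivity (\sum_(h <- quaternion_tuples R N) (2 * \tr (A *m A) -
   2 * \tr (U^t* *m ((local_unitary h)^t* *m A *m local_unitary h) *m U *m A))).
  apply: eq_bigr => h _; rewrite frobenius_commx ?local_unitary_unitary//.
  by rewrite local_unitaryM trmx_mul map_mxM !mulmxA.
rewrite sumrB big_const_seq count_predT iter_addr_0 size_quaternion_tuples.
rewrite -mulr_sumr -raddf_sum -mulmx_suml -mulmx_suml -mulmx_sumr.
rewrite quaternion_twirl mul_mx_scalar -!scalemxAl VU mul1mx /= mxtraceZ.
rewrite -[_ *+ (4 ^ N)]mulr_natl natrX mulrBr; congr (_ - _).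
(* The factor 2^N of the twirl has to match 4^N / 2^N. *)
have -> : (4 : R[i]) = 2 * 2 by rewrite -natrM.
rewrite exprMn; field.
by rewrite expf_neq0// pnatr_eq0.
Qed.

End frobenius.

(** * Haar integral of the squared commutator norm *)

Lemma frobenius_sqr_measurable d (T : measurableType d) (R : realType) n
    (A : T -> 'M[R[i]]_n) :
  mx_measurable A -> measurable_fun setT (fun x => frobenius (A x) ^+ 2).
Proof.
move=> mA; under eq_fun do rewrite frobenius_sqr.
apply: measurable_sum => i; apply: measurable_sum => j.
by have [mR mI] := mA i j; apply: measurable_funD; exact: measurable_funX.
Qed.

Section asymmetry.
Context (R : realType) (mu : probability (SU2 R) R) (mu_haar : su2_haar mu).

(** By invariance, [size s] times the integral is the integral of the sum of translates, a constant
    integrated against total mass 1. *)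
Lemma power_haar_average N (s : seq (N.-tuple (SU2 R)))
    (f : N.-tuple (SU2 R) -> R) (c : R) :
  (0 < size s)%N -> measurable_fun setT f -> (forall g, 0 <= f g) ->
  (forall g, \sum_(h <- s) f (tuple_mul h g) = (size s)%:R * c) ->
  (\int[power_prob mu N]_g (f g))%R = c.
Proof.
move=> s0 mf f0 fc; rewrite /Rintegral.
have mfE : measurable_fun setT (EFin \o f) by exact/measurable_EFinP.
set I := (X in fine X).
have sI : ((size s)%:R%:E * I = ((size s)%:R * c)%:E)%E.
  transitivity (\int[power_prob mu N]_g \sum_(h <- s) (f (tuple_mul h g))%:E)%E.
    rewrite ge0_integral_sum//; last 2 first.
    - move=> h; apply: measurableT_comp mfE _; exact: tuple_mul_measurable.
    - by move=> h g _; rewrite lee_fin.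
    under eq_bigr do rewrite (power_haar_integral mu_haar _ mfE)//.
    rewrite big_const_seq count_predT iter_addr_0.
    exact: mule_natl.
  under eq_integral do rewrite sumEFin fc.
  by rewrite integral_cst//= probability_setT mule1.
have sn0 : (size s)%:R != 0 :> R by rewrite pnatr_eq0 -lt0n.
(* The integral is a priori only an extended real; a finite multiple of it excludes both infinities,
   so [fine] yields its true value. *)
move: sI; case: I => [r| |].
- by rewrite -EFinM => -[] /(mulfI sn0).
- by rewrite gt0_muley// lte_fin ltr0n.
- by rewrite gt0_muleNy// lte_fin ltr0n.
Qed.

Lemma commx_integral N (A : 'M[R[i]]_(2 ^ N)) :
  A \is hermsymmx ->
  ((\int[power_prob mu N]_g (frobenius (commx (local_unitary g) A) ^+ 2))%R)%:C
    = 2 * \tr (A *m A) - 2 * \tr A ^+ 2 / 2 ^+ N.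
Proof.
move=> AH; set c := RHS.
have s4 : (size (quaternion_tuples R N))%:R = 4 ^+ N :> R[i].
  by rewrite size_quaternion_tuples natrX.
have sE g : (\sum_(h <- quaternion_tuples R N)
    frobenius (commx (local_unitary (tuple_mul h g)) A) ^+ 2)%:C = 4 ^+ N * c.
  by rewrite rmorph_sum /= frobenius_commx_mean.
have n0 : 4 ^+ N != 0 :> R[i] by rewrite expf_neq0// pnatr_eq0.
(* The averaging lemma needs a real constant. Evaluating the design sum at any one tuple, here the
   identity, shows that [c] is real. *)
have cE : c = (complex.Re c)%:C.
  rewrite -[c](mulKf n0) -(sE [tuple of nseq N 1%g]) -s4.
  by rewrite -(rmorph_nat (real_complex R)) -fmorphV -rmorphM.
rewrite [RHS]cE; congr (_%:C).
apply: (@power_haar_average _ (quaternion_tuples R N)).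
- by rewrite size_quaternion_tuples expn_gt0.
- apply: frobenius_sqr_measurable; apply: mx_measurableB; apply: mx_measurableM;
    by [exact: local_unitary_measurable|exact: mx_measurable_cst].
- by move=> g; exact: sqr_ge0.
- move=> g; apply: complexI; rewrite sE rmorphM /= -cE; congr (_ * _).
  by rewrite rmorph_nat s4.
Qed.

End asymmetry.

Theorem mainTheorem2 (R : realType) (mu : probability (SU2 R) R)
    (mu_haar : su2_haar mu) (N : nat) (N_ge1 : (1 <= N)%N)
    (rho : 'M[R[i]]_(2 ^ N)) (rho_density : density_mx rho) :
  let A := asymmetry (power_prob mu N) (@local_unitary R N) rho in
  [/\ A%:C = 1 / 2 - 1 / (2 ^+ N.+1 * \tr (rho *m rho)),
      A = 1 / 2 - 1 / (2 + 2 * (2 ^+ N - 1) * coherence rho ^+ 2) &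
      A%:C = 1 / 2 - 1 / (2 + 2 ^+ N.+1 * bz_information rho)].
Proof.
move=> A; have [[rhoH _] tr1] := rho_density.
have := commx_integral mu_haar rhoH; rewrite tr1 expr1n mulr1.
set P := frobenius rho ^+ 2; set I := (X in X%:C = _) => IE.
have PE : P%:C = \tr (rho *m rho).
  by rewrite frobenius_sqr_trace (hermsymmx_adj rhoH).
(* The purity is a denominator; unit trace excludes the zero matrix. *)
have P0 : P != 0.
  apply/eqP => /frobenius_sqr_eq0 rho0; move: tr1; rewrite rho0 mxtrace0.
  by move/eqP; rewrite eq_sym oner_eq0.
have d0 : 2 ^+ N != 0 :> R by rewrite expf_neq0// pnatr_eq0.
have I2 : I = 2 * P - 2 / 2 ^+ N.
  apply: complexI; rewrite IE -PE rmorphB !rmorphM fmorphV rmorphXn.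
  by rewrite !rmorph_nat.
have dC : ((2 ^+ N)^-1 : R)%:C = (2 ^+ N)^-1 :> R[i].
  by rewrite fmorphV rmorphXn rmorph_nat.
have AE : A = 1 / 2 - 1 / (2 ^+ N.+1 * P).
  rewrite /A /asymmetry -/I -/P I2 exprS; field.
  by rewrite P0 d0.
(* Here N >= 1 enters: the coherence divides by d - 1. *)
have d1 : 2 ^+ N - 1 != 0 :> R.
  by rewrite subr_eq0 gt_eqF// exprn_egt1// ?ltr1n// -lt0n.
(* Expanding the norm of the hermitian matrix rho - 1/d gives Tr rho^2 - 2/d + 1/d, since rho has
   trace 1. *)
have CE : coherence rho ^+ 2 = 2 ^+ N / (2 ^+ N - 1) * (P - (2 ^+ N)^-1).
  have adj : (rho - ((2 ^ N)%:R^-1)%:M)^t* = rho - ((2 ^ N)%:R^-1)%:M.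
    by rewrite raddfB /= tr_scalar_mx map_mxB map_scalar_mx (hermsymmx_adj rhoH)
      fmorphV rmorph_nat.
  rewrite exprMn sqr_sqrtr; last first.
    by rewrite divr_ge0 ?ler0n// subr_ge0 ler1n expn_gt0.
  rewrite natrX; congr (_ * _); apply: complexI.
  rewrite frobenius_sqr_trace adj mulmxBl !mulmxBr !raddfB /= mul_scalar_mx.
  rewrite mul_mx_scalar mul_scalar_mx !mxtraceZ tr1 mxtrace_scalar -PE.
  rewrite -[_^-1 *+ _]mulr_natl !natrX dC; field.
  by rewrite expf_neq0// pnatr_eq0.
have ACE : A%:C = 1 / 2 - 1 / (2 ^+ N.+1 * \tr (rho *m rho)).
  rewrite -PE AE !div1r rmorphB !fmorphV rmorphM rmorphXn.
  by rewrite !rmorph_nat.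
(* The denominators with the coherence and with the Brukner-Zeilinger information both simplify to
   2^(N+1) Tr rho^2. *)
split => //.
- rewrite AE CE; congr (_ - 1 / _); rewrite exprS; field.
  by rewrite d0 d1.
- rewrite ACE; congr (_ - 1 / _); rewrite /bz_information natrX exprS; field.
  by rewrite expf_neq0// pnatr_eq0.
Qed.
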